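(* Let $A$ be a real $n\times m$ matrix and let $\delta,\varepsilon>0$. Then an $\varepsilon$-row echelon form $A_\varepsilon$ of $A$ exists. Moreover, one can write $A_\varepsilon=R_1S_1\cdots R_kS_k\,A\,C_1\cdots C_k$ with $k\leq\min(n,m)$, where for each $i$, $R_i$ is an identity matrix in which two rows are swapped, $C_i$ is an identity matrix in which two columns are swapped, and $S_i$ is a row addition matrix satisfying $\lVert S_i\rVert_{\max}<1+\delta$.
   Context: The setting is Bishop-style constructive mathematics (intuitionistic logic; the law of excluded middle is not available). For real numbers, $x\neq y$ (apart) means there is a rational $q>0$ with $|x-y|>q$. $\lVert A\rVert_{\max}=\max_{i,j}|A_{i,j}|$. An $n\times m$ matrix $B$ is in $\varepsilon$-row echelon form, with $k$ leading columns ($0\le k\le\min(n,m)$), if: (1) the first $k$ columns are in triangular form with diagonal entries apart from $0$, i.e. $B_{j,j}\neq0$ for $j\leq k$ and $B_{i,j}=0$ whenever $j\leq k$ and $i>j$; (2) the residual matrix $E$, consisting of the last $n-k$ rows and last $m-k$ columns of $B$, satisfies $\lVert E\rVert_{\max}<\varepsilon$ (vacuous if $E$ is empty). The stable operations are row swapping, adding a multiple of a row to another row, and column swapping. An $\varepsilon$-row echelon form of $A$ is a matrix in $\varepsilon$-row echelon form obtained from $A$ by finitely many stable operations. The identity matrix itself counts as a (trivial) row swap or column swap matrix. A row addition matrix here is an $n\times n$ matrix whose left multiplication adds multiples of one fixed row to the other rows, i.e. an identity matrix in which the off-diagonal entries of one single column may be arbitrary. *)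

(* Defs.v *)
From mathcomp Require Import all_boot perm matrix.
From Stdlib Require Import QArith.
From Stdlib.Reals.Abstract Require Export ConstructiveReals.
From Stdlib.Reals.Abstract Require Import ConstructiveAbs ConstructiveMinMax.

Set Implicit Arguments.
Unset Strict Implicit.
Unset Printing Implicit Defensive.

Local Open Scope nat_scope.

(* Constructive reading.  [R : ConstructiveReals] is any implementation of the
   constructive real numbers; its equality is the setoid equality [CReq], its
   apartness [CRapart], and its strict order lives in [Set].  Mathematical
   existence is rendered by sigma types, and predicates that carry
   computational content (strict inequalities, apartness, existential
   witnesses) live in [Type].  Real numbers have no decidable equality, so
   only the structural part of the MathComp matrix library (which works over
   an arbitrary carrier type) is available; products, norms and equality of
   matrices are defined here. *)

(* The library's apartness is x < y or y < x; it agrees with "|x - y| > q for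
   some rational q > 0". *)
Lemma CRapart_rational (R : ConstructiveReals) (x y : CRcarrier R) :
  CRelationClasses.iffT (CRapart R x y)
    {q : Q & ((0 < q)%Q *
              CRlt R (CR_of_Q R q) (CRabs R (CRminus R x y)))%type}.
Proof.
split.
- move=> xy.
  have pos : CRlt R (CR_of_Q R 0) (CRabs R (CRminus R x y)).
    case: xy => h.
    + apply: (@CRlt_le_trans R _ (CRminus R y x)).
        apply: (@CRplus_lt_reg_l R x).
        rewrite CRplus_0_r /CRminus (CRplus_comm y) -CRplus_assoc.
        by rewrite CRplus_opp_r CRplus_0_l.
      rewrite CRabs_minus_sym; exact: CRle_abs.
    + apply: (@CRlt_le_trans R _ (CRminus R x y)); last exact: CRle_abs.
      apply: (@CRplus_lt_reg_l R y).
      rewrite CRplus_0_r /CRminus (CRplus_comm x) -CRplus_assoc.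
      by rewrite CRplus_opp_r CRplus_0_l.
  case: (CR_Q_dense R _ _ pos) => q [q0 qxy].
  by exists q; split => //; apply: (lt_CR_of_Q R).
- case=> q [q0 qxy].
  have pos := CRlt_trans _ _ _ (CR_of_Q_lt R _ _ q0) qxy.
  case: (CRabs_appart_0 _ pos) => h; [left | right].
  + apply: (@CRplus_lt_reg_l R (CRopp R y)).
    by rewrite CRplus_opp_l CRplus_comm.
  + apply: (@CRplus_lt_reg_l R (CRopp R y)).
    by rewrite CRplus_opp_l CRplus_comm.
Qed.

Section Matrices.

Variable R : ConstructiveReals.
Local Notation T := (CRcarrier R).

Definition meq n m (A B : 'M[T]_(n, m)) : Prop :=
  forall i j, CReq R (A i j) (B i j).

Definition cmx1 n : 'M[T]_n :=
  \matrix_(i, j) if i == j then 1%ConstructiveReals else 0%ConstructiveReals.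

Definition cmulmx n p m (A : 'M[T]_(n, p)) (B : 'M[T]_(p, m)) : 'M[T]_(n, m) :=
  \matrix_(i, j)
    \big[@CRplus R / 0%ConstructiveReals]_(l < p) CRmult R (A i l) (B l j).

(* As absolute values are nonnegative, starting from 0 does not change the
   maximum of a nonempty matrix; the norm of an empty matrix is 0. *)
Definition mxnorm n m (A : 'M[T]_(n, m)) : T :=
  \big[@CRmax R / 0%ConstructiveReals]_(i < n)
    \big[@CRmax R / 0%ConstructiveReals]_(j < m) CRabs R (A i j).

Lemma tail_ord_subproof k n (i : 'I_(n - k)) : k + i < n.
Proof. by rewrite -ltn_subRL. Qed.

Definition tail_ord k n (i : 'I_(n - k)) : 'I_n :=
  Ordinal (tail_ord_subproof i).

Definition residual k n m (B : 'M[T]_(n, m)) : 'M[T]_(n - k, m - k) :=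
  mxsub (@tail_ord k n) (@tail_ord k m) B.

(* Indices start at 0, so the leading columns are those with index j < k. *)
Record echelon_form_with (eps : T) (k n m : nat) (B : 'M[T]_(n, m)) : Type := {
  echelon_size : k <= minn n m;
  echelon_diag : forall (i : 'I_n) (j : 'I_m),
    j < k -> i = j :> nat -> CRapart R (B i j) 0%ConstructiveReals;
  echelon_below : forall (i : 'I_n) (j : 'I_m),
    j < k -> j < i -> CReq R (B i j) 0%ConstructiveReals;
  echelon_residual : CRlt R (mxnorm (residual k B)) eps
}.

Definition echelon_form (eps : T) n m (B : 'M[T]_(n, m)) : Type :=
  {k : nat & echelon_form_with eps k B}.

Definition row_add n m (i1 i2 : 'I_n) (c : T) (A : 'M[T]_(n, m)) :
    'M[T]_(n, m) :=
  \matrix_(i, j)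
    if i == i2 then CRplus R (A i j) (CRmult R c (A i1 j)) else A i j.

Inductive stable_op n m (A : 'M[T]_(n, m)) : 'M[T]_(n, m) -> Type :=
| Stable_row_swap i1 i2 : stable_op A (xrow i1 i2 A)
| Stable_row_add i1 i2 c : i1 != i2 -> stable_op A (row_add i1 i2 c A)
| Stable_col_swap j1 j2 : stable_op A (xcol j1 j2 A).

Inductive stable_ops n m (A : 'M[T]_(n, m)) : 'M[T]_(n, m) -> Type :=
| Stable_nil B : meq A B -> stable_ops A B
| Stable_cons B C : stable_op A B -> stable_ops B C -> stable_ops A C.

Definition echelon_form_of (eps : T) n m (A B : 'M[T]_(n, m)) : Type :=
  (echelon_form eps B * stable_ops A B)%type.

(* The two indices may coincide: the identity is a trivial swap matrix. *)
Definition row_swap_mx n (P : 'M[T]_n) : Type :=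
  {i1 : 'I_n & {i2 : 'I_n | meq P (xrow i1 i2 (cmx1 n))}}.

Definition col_swap_mx n (P : 'M[T]_n) : Type :=
  {j1 : 'I_n & {j2 : 'I_n | meq P (xcol j1 j2 (cmx1 n))}}.

(* p is the row whose multiples are added to the other rows, so column p is
   the only one with arbitrary off-diagonal entries. *)
Definition row_addition_mx n (S : 'M[T]_n) : Type :=
  {p : 'I_n | forall i j : 'I_n, (i == j) || (j != p) ->
                CReq R (S i j) (cmx1 n i j)}.

End Matrices.

(* Main.v *)
Require Import Defs.
From mathcomp Require Import all_boot perm matrix.
From Stdlib Require Import Ring Morphisms.
From Stdlib.Reals.Abstract Require Import ConstructiveAbs ConstructiveMinMax.

Set Implicit Arguments.
Unset Strict Implicit.
Unset Printing Implicit Defensive.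

(** The form is reached by Gaussian elimination with complete pivoting, in
    which both classical appeals to decidability are replaced by approximate
    decisions.

    Suppose that the first k columns are already triangular, with residual
    matrix E.  Whether E vanishes cannot be decided, but since 0 < eps,
    cotransitivity of the order yields the norm of E < eps or 0 < the norm of
    E.  In the first case the matrix is in echelon form.  In the second, an
    entry of E of largest absolute value cannot be located, but an entry B p q
    with |E i j| < (1 + delta) |B p q| for all i, j can
    ([approximate_pivot]).  It is apart from 0, so the multiples
    - B i q / B p q of row p clear the rest of column q of E, and their
    absolute values are below 1 + delta ([multiplier_lt]).  Swapping row p with
    row k and column q with column k then gives one more triangular column
    ([eliminate_triangular]).  As k cannot exceed min(n, m), at which point E
    is empty, the process stops ([elimination]).

    The row addition is performed before the row swap, with the pivot row left
    where it was found, because S stands to the right of R in the factorization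
    and so acts first.  One elimination step contributes one factor R S on the
    left and one factor C on the right, hence the number of factors is the
    number of triangular columns ([eliminate_factorization]).

    Equality of reals is a setoid equality, so matrix algebra is developed up
    to it; only associativity and units of the matrix product are used. *)

Section ConstructiveGauss.

Variable R : ConstructiveReals.

Add Ring CRring : (CRisRing R).

#[local] Hint Resolve CReq_refl CRle_refl : core.

Local Open Scope ConstructiveReals.

Local Notation T := (CRcarrier R).
Local Notation "\sum_ ( i <- r ) F" :=
  (\big[@CRplus R/0]_(i <- r) F) : ConstructiveReals.
Local Notation "\sum_ ( i < n ) F" :=
  (\big[@CRplus R/0]_(i < n) F) : ConstructiveReals.
Local Notation "\max_ ( i <- r ) F" :=
  (\big[@CRmax R/0]_(i <- r) F) : ConstructiveReals.
Local Notation "A ** B" := (cmulmx A B) (at level 40, left associativity).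
Local Notation "A =m B" := (meq A B) (at level 70, no associativity).

(** * Finite sums up to setoid equality *)

Section Sums.

Variable I : Type.
Implicit Types (r : seq I) (F G : I -> T).

Lemma sum_ext r F G :
  (forall i, F i == G i) -> \sum_(i <- r) F i == \sum_(i <- r) G i.
Proof.
move=> FG; elim: r => [|x r IH]; first by rewrite !big_nil.
by rewrite !big_cons FG IH.
Qed.

Lemma sum_zero r F : (forall i, F i == 0) -> \sum_(i <- r) F i == 0.
Proof.
move=> F0; elim: r => [|x r IH]; first by rewrite big_nil.
by rewrite big_cons F0 IH CRplus_0_l.
Qed.

Lemma sum_add r F G :
  \sum_(i <- r) (F i + G i) == \sum_(i <- r) F i + \sum_(i <- r) G i.
Proof.
elim: r => [|x r IH]; first by rewrite !big_nil CRplus_0_l.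
by rewrite !big_cons IH; ring.
Qed.

Lemma sum_mull r c F : c * (\sum_(i <- r) F i) == \sum_(i <- r) (c * F i).
Proof.
elim: r => [|x r IH]; first by rewrite !big_nil CRmult_0_r.
by rewrite !big_cons -IH; ring.
Qed.

Lemma sum_mulr r c F : (\sum_(i <- r) F i) * c == \sum_(i <- r) (F i * c).
Proof.
elim: r => [|x r IH]; first by rewrite !big_nil CRmult_0_l.
by rewrite !big_cons -IH; ring.
Qed.

End Sums.

Lemma sum_exchange (I J : Type) (r : seq I) (s : seq J) (F : I -> J -> T) :
  \sum_(i <- r) \sum_(j <- s) F i j == \sum_(j <- s) \sum_(i <- r) F i j.
Proof.
elim: r => [|x r IH].
  by rewrite big_nil sum_zero // => j; rewrite big_nil.
rewrite big_cons IH -sum_add; apply: sum_ext => j.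
by rewrite big_cons.
Qed.

Lemma sum_single (I : eqType) (r : seq I) (i : I) (F : I -> T) :
  uniq r -> i \in r -> (forall j, j != i -> F j == 0) ->
  \sum_(j <- r) F j == F i.
Proof.
move=> + + F0; elim: r => [|x r IH] //= /andP[xr ur].
rewrite big_cons inE; case: (eqVneq i x) => [ix|ix]; last first.
  by move=> /= ir; rewrite IH // F0 1?eq_sym // CRplus_0_l.
move=> _; subst x; rewrite -[X in _ == X]CRplus_0_r; apply: CRplus_morph => //.
elim: r xr {IH ur} => [|y r IH]; first by rewrite big_nil.
rewrite inE negb_or => /andP[xy xr]; rewrite big_cons IH // F0 1?eq_sym //.
by rewrite CRplus_0_l.
Qed.

Lemma sum_ord_single n (i : 'I_n) (F : 'I_n -> T) :
  (forall j, j != i -> F j == 0) -> \sum_(j < n) F j == F i.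
Proof. by apply: sum_single; rewrite ?index_enum_uniq ?mem_index_enum. Qed.

(** * The monoid of matrices up to setoid equality *)

#[local] Instance meq_equivalence n m : Equivalence (@meq R n m).
Proof.
split=> [A i j | A B AB i j | A B C AB BC i j].
- reflexivity.
- by symmetry.
- by transitivity (B i j).
Qed.

#[local] Instance cmulmx_proper n p m :
  Proper (@meq R n p ==> @meq R p m ==> @meq R n m) (@cmulmx R n p m).
Proof.
move=> A A' AA B B' BB i j; rewrite !mxE; apply: sum_ext => l.
by rewrite (AA i l) (BB l j).
Qed.

Lemma cmulmxA n p q m (A : 'M[T]_(n, p)) (B : 'M[T]_(p, q)) (C : 'M[T]_(q, m)) :
  A ** (B ** C) =m (A ** B) ** C.
Proof.
move=> i j; rewrite !mxE.
transitivity (\sum_(l < p) \sum_(h < q) (A i l * B l h * C h j)).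
  apply: sum_ext => l; rewrite mxE sum_mull; apply: sum_ext => h; ring.
rewrite sum_exchange; apply: sum_ext => h.
by rewrite mxE sum_mulr.
Qed.

Lemma cmx1_diag n (i : 'I_n) : cmx1 R n i i = 1.
Proof. by rewrite mxE eqxx. Qed.

Lemma cmx1_offdiag n (i j : 'I_n) : i != j -> cmx1 R n i j = 0.
Proof. by rewrite mxE => /negbTE ->. Qed.

Lemma cmul1mx n m (A : 'M[T]_(n, m)) : cmx1 R n ** A =m A.
Proof.
move=> i j; rewrite mxE (sum_ord_single (i := i)) => [|l li].
  by rewrite cmx1_diag CRmult_1_l.
by rewrite cmx1_offdiag 1?eq_sym // CRmult_0_l.
Qed.

Lemma cmulmx1 n m (A : 'M[T]_(n, m)) : A ** cmx1 R m =m A.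
Proof.
move=> i j; rewrite mxE (sum_ord_single (i := j)) => [|l lj].
  by rewrite cmx1_diag CRmult_1_r.
by rewrite cmx1_offdiag // CRmult_0_r.
Qed.

(** The product is a monoid law only up to setoid equality, so the last factor
    of an iterated product has to be split off by induction.  It is needed for
    the column swaps, each of which is appended on the right. *)
Lemma prod_recr n k (F : 'I_k.+1 -> 'M[T]_n) :
  \big[@cmulmx R n n n/cmx1 R n]_(i < k.+1) F i =m
  (\big[@cmulmx R n n n/cmx1 R n]_(i < k) F (lift ord_max i)) ** F ord_max.
Proof.
elim: k F => [|k IH] F.
  rewrite big_ord_recl !big_ord0 cmulmx1 cmul1mx.
  by rewrite (_ : ord0 = ord_max) //; apply: val_inj.
rewrite big_ord_recl (IH (fun i => F (lift ord0 i))).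
rewrite [in X in _ =m X]big_ord_recl.
rewrite cmulmxA (_ : lift ord0 ord_max = ord_max); last exact: val_inj.
rewrite (_ : lift ord_max ord0 = ord0); last exact: val_inj.
suff -> : \big[@cmulmx R n n n/cmx1 R n]_(i < k) F (lift ord0 (lift ord_max i))
  = \big[@cmulmx R n n n/cmx1 R n]_(i < k) F (lift ord_max (lift ord0 i)) by [].
apply: eq_bigr => i _; congr F; apply: val_inj => /=.
by rewrite /bump /= !add1n ltnS; case: leqP.
Qed.

(** * Elementary matrices and the operations they perform *)

Lemma row_swap_mxE n m (i1 i2 : 'I_n) (A : 'M[T]_(n, m)) :
  xrow i1 i2 (cmx1 R n) ** A =m xrow i1 i2 A.
Proof.
move=> i j; rewrite [X in _ == X]mxE -(cmul1mx A _ j) !mxE.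
by apply: sum_ext => l; rewrite !mxE.
Qed.

Lemma col_swap_mxE n m (j1 j2 : 'I_m) (A : 'M[T]_(n, m)) :
  A ** xcol j1 j2 (cmx1 R m) =m xcol j1 j2 A.
Proof.
move=> i j; rewrite [X in _ == X]mxE -(cmulmx1 A i) !mxE.
by apply: sum_ext => l; rewrite !mxE.
Qed.

Definition row_addition n (p : 'I_n) (c : 'I_n -> T) : 'M[T]_n :=
  \matrix_(i, j) if (i == j)%B then 1 else if (j == p)%B then c i else 0.

Definition add_rows n m (p : 'I_n) (c : 'I_n -> T) (A : 'M[T]_(n, m)) :
    'M[T]_(n, m) :=
  \matrix_(i, j) (A i j + c i * A p j).

Lemma row_addition_mxP n (p : 'I_n) c : row_addition_mx (row_addition p c).
Proof.
exists p => i j; rewrite !mxE.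
by case: eqVneq => //= _ /negbTE ->.
Qed.

Lemma row_additionE n m (p : 'I_n) c (A : 'M[T]_(n, m)) :
  c p == 0 -> row_addition p c ** A =m add_rows p c A.
Proof.
move=> cp i j; rewrite !mxE.
transitivity (\sum_(l < n) (cmx1 R n i l * A l j
                            + (if (l == p)%B then c i else 0) * A l j)).
  apply: sum_ext => l; rewrite !mxE; case: (eqVneq i l) => [<-|_]; last by ring.
  case: (eqVneq i p) => [->|_]; last by ring.
  by rewrite cp; ring.
rewrite sum_add; apply: CRplus_morph.
  by rewrite -(cmul1mx A i j) mxE.
rewrite (sum_ord_single (i := p)) ?eqxx // => l /negbTE ->.
by rewrite CRmult_0_l.
Qed.

Lemma stable_ops_meq n m (A B C : 'M[T]_(n, m)) :
  stable_ops A B -> B =m C -> stable_ops A C.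
Proof.
move=> AB BC; elim: AB BC => [A' B' AB|A' B' C' op _ IH] BC.
  by apply: Stable_nil; transitivity B'.
exact: Stable_cons op (IH BC).
Qed.

(** Stable operations respect setoid equality only up to changing their result,
    because [stable_op] computes it on the nose. *)
Lemma stable_op_meq n m (A A' B : 'M[T]_(n, m)) :
  A =m A' -> stable_op A' B -> {B' & (stable_op A B' * (B' =m B))%type}.
Proof.
move=> AA [i1 i2|i1 i2 c i12|j1 j2].
- exists (xrow i1 i2 A); split; first exact: Stable_row_swap.
  by move=> i j; rewrite !mxE.
- exists (row_add i1 i2 c A); split; first exact: Stable_row_add.
  move=> i j; rewrite !mxE; case: eqP => _; last exact: AA.
  by rewrite (AA i j) (AA i1 j).
- exists (xcol j1 j2 A); split; first exact: Stable_col_swap.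
  by move=> i j; rewrite !mxE.
Qed.

Lemma stable_ops_rcons n m (A B C : 'M[T]_(n, m)) :
  stable_ops A B -> stable_op B C -> stable_ops A C.
Proof.
elim=> [A' B' AB|A' B' C' op _ IH] BC; last exact: Stable_cons op (IH BC).
have [C' [op CC]] := stable_op_meq AB BC.
exact: Stable_cons op (Stable_nil CC).
Qed.

(** Adding multiples of row p to all the rows is done one row at a time: as row
    p itself never changes, each addition uses the original row p. *)
Lemma stable_ops_add_rows n m (p : 'I_n) c (A B : 'M[T]_(n, m)) :
  c p == 0 -> stable_ops A B -> stable_ops A (add_rows p c B).
Proof.
move=> cp AB.
(* the matrix once the rows listed in r have been treated *)
pose N (r : seq 'I_n) : 'M[T]_(n, m) :=
  (\matrix_(i, j) if i \in r then add_rows p c B i j else B i j)%R.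
have Np r j : N r p j == B p j.
  by rewrite !mxE; case: ifP => // _; rewrite cp; ring.
suff AN r : uniq r -> stable_ops A (N r).
  apply: stable_ops_meq (AN _ (enum_uniq 'I_n)) _ => i j.
  by rewrite mxE mem_enum.
elim: r => [_|x r IH /= /andP[xr /IH ANr]].
  by apply: stable_ops_meq AB _ => i j; rewrite mxE.
case: (eqVneq p x) => px.
  apply: stable_ops_meq ANr _ => i j.
  case: (eqVneq i p) => [->|ip]; first by rewrite !Np.
  by rewrite [N r i j]mxE [N (x :: r) i j]mxE inE -px (negbTE ip).
apply: stable_ops_meq (stable_ops_rcons ANr (Stable_row_add _ (c x) px)) _.
move=> i j; rewrite [row_add _ _ _ _ i j]mxE [N (x :: r) i j]mxE inE.
case: eqVneq => [->|_] /=; last by rewrite mxE.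
by rewrite Np !mxE (negbTE xr).
Qed.

(** * Maximum norm and approximate pivots *)

(** Being below the larger of two numbers cannot be turned into a comparison of
    these numbers; cotransitivity against a, then against b, suffices, since the
    maximum cannot exceed both strictly. *)
Lemma lt_max_cases (x a b : T) : x < CRmax a b -> (x < a) + (x < b).
Proof.
move=> xm; have cotrans := snd (CRltLinear R).
case: (cotrans x a _ xm) => [|a_lt]; first by left.
case: (cotrans x b _ xm) => [|b_lt]; first by right.
by case: (CRle_refl _ (CRmax_lub_lt _ _ _ a_lt b_lt)).
Qed.

Lemma lt_bigmax_witness (I : Type) (r : seq I) (F : I -> T) x :
  0 <= x -> x < \max_(i <- r) F i -> {i & x < F i}.
Proof.
move=> x0; elim: r => [|y r IH]; first by rewrite big_nil.
by rewrite big_cons => /lt_max_cases[|/IH //]; exists y.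
Qed.

Lemma le_bigmax (I : eqType) (r : seq I) (F : I -> T) i :
  i \in r -> F i <= \max_(j <- r) F j.
Proof.
elim: r => [|y r IH] //; rewrite inE big_cons; case: eqP => [-> _|_ /= /IH].
  exact: CRmax_l.
by move=> Fi; apply: CRle_trans Fi (CRmax_r _ _).
Qed.

Lemma bigmax_lt (I : Type) (r : seq I) (F : I -> T) x :
  0 < x -> (forall i, F i < x) -> \max_(i <- r) F i < x.
Proof.
move=> x0 Fx; elim: r => [|y r IH]; first by rewrite big_nil.
by rewrite big_cons; apply: CRmax_lub_lt.
Qed.

Lemma le_mxnorm n m (A : 'M[T]_(n, m)) i j : CRabs R (A i j) <= mxnorm A.
Proof.
pose rowmax i' := \max_(j' <- index_enum 'I_m) CRabs R (A i' j').
apply: (CRle_trans _ (rowmax i)).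
  exact: (le_bigmax (F := fun j' => CRabs R (A i j')) (mem_index_enum j)).
exact: (le_bigmax (F := rowmax) (mem_index_enum i)).
Qed.

Arguments le_mxnorm {n m} A i j _.

Lemma mxnorm_lt n m (A : 'M[T]_(n, m)) x :
  0 < x -> (forall i j, CRabs R (A i j) < x) -> mxnorm A < x.
Proof. by move=> x0 Ax; apply: bigmax_lt => // i; apply: bigmax_lt. Qed.

Lemma lt_mxnorm_witness n m (A : 'M[T]_(n, m)) x :
  0 <= x -> x < mxnorm A -> {i & {j & x < CRabs R (A i j)}}.
Proof.
move=> x0 /lt_bigmax_witness[] // i /lt_bigmax_witness[] // j xA.
by exists i, j.
Qed.

Lemma one_plus_gt1 (delta : T) : 0 < delta -> 1 < 1 + delta.
Proof.
move=> d0; rewrite -{1}[1]CRplus_0_r; exact: CRplus_lt_compat_l.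
Qed.

Lemma one_plus_gt0 (delta : T) : 0 < delta -> 0 < 1 + delta.
Proof. by move=> /one_plus_gt1; apply: CRlt_trans; exact: CRzero_lt_one. Qed.

(** The norm divided by 1 + delta is strictly below the norm, hence some entry
    exceeds it in absolute value; every entry is at most the norm, and so below
    1 + delta times the entry found. *)
Lemma approximate_pivot n m (A : 'M[T]_(n, m)) delta :
  0 < delta -> 0 < mxnorm A ->
  {p & {q & forall i j, CRabs R (A i j) < (1 + delta) * CRabs R (A p q)}}.
Proof.
move=> d0 A0; set a := 1 + delta.
have a1 : 1 < a by exact: one_plus_gt1.
have a0 : 0 < a by exact: one_plus_gt0.
pose t := mxnorm A * (/ a) (inr a0).
have ta : t * a == mxnorm A by rewrite /t CRmult_assoc CRinv_l CRmult_1_r.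
have t0 : 0 < t by apply: CRmult_lt_0_compat => //; apply: CRinv_0_lt_compat.
have tA : t < mxnorm A.
  by rewrite -ta -{1}[t]CRmult_1_r; apply: CRmult_lt_compat_l.
have [p [q tpq]] := lt_mxnorm_witness (CRlt_asym _ _ t0) tA.
exists p, q => i j; apply: (CRle_lt_trans _ _ _ (le_mxnorm A i j)).
by rewrite -ta (CRmult_comm a); apply: CRmult_lt_compat_r.
Qed.


(** * Factorizations into k elimination steps *)

Definition factorization n m (delta : T) (k : nat) (A B : 'M[T]_(n, m)) :
    Type :=
  {P : 'I_k -> 'M[T]_n & {S : 'I_k -> 'M[T]_n & {C : 'I_k -> 'M[T]_m &
    ((forall i, row_swap_mx (P i)) *
     (forall i, row_addition_mx (S i)) *
     (forall i, (mxnorm (S i) < 1 + delta)%ConstructiveReals) *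
     (forall i, col_swap_mx (C i)) *
     (B =m (\big[@cmulmx R n n n/cmx1 R n]_(i < k) (P i ** S i)) ** A **
           (\big[@cmulmx R m m m/cmx1 R m]_(i < k) C i)))%type}}}.

Definition insert X k (h : 'I_k.+1) (x : X) (F : 'I_k -> X) (i : 'I_k.+1) : X :=
  if unlift h i is Some j then F j else x.

Lemma insert_at X k h (x : X) (F : 'I_k -> X) : insert h x F h = x.
Proof. by rewrite /insert unlift_none. Qed.

Lemma insert_lift X k h (x : X) (F : 'I_k -> X) i :
  insert h x F (lift h i) = F i.
Proof. by rewrite /insert liftK. Qed.

Lemma insertP X k h (x : X) (F : 'I_k -> X) (Q : X -> Type) :
  Q x -> (forall i, Q (F i)) -> forall i, Q (insert h x F i).
Proof. by move=> Qx QF i; rewrite /insert; case: unlift. Qed.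

Lemma factorization0 n m delta (A : 'M[T]_(n, m)) : factorization delta 0 A A.
Proof.
exists (fun=> cmx1 R n), (fun=> cmx1 R n), (fun=> cmx1 R m).
split; last by rewrite !big_ord0 cmulmx1 cmul1mx.
by do !split; case.
Qed.

(** A further step multiplies on the left by P S, which thus becomes the first
    of the left factors, and on the right by C, the last of the right ones. *)
Lemma factorizationS n m delta k (A B B' : 'M[T]_(n, m)) P S C :
  row_swap_mx P -> row_addition_mx S -> mxnorm S < 1 + delta -> col_swap_mx C ->
  B' =m P ** (S ** B) ** C ->
  factorization delta k A B -> factorization delta k.+1 A B'.
Proof.
move=> rP rS nS cC B'E [Ps [Ss [Cs [[[[rPs rSs] nSs] cCs] BE]]]].
exists (insert ord0 P Ps), (insert ord0 S Ss), (insert ord_max C Cs).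
split; last first.
  rewrite big_ord_recl prod_recr !insert_at.
  rewrite (eq_bigr (fun i => Ps i ** Ss i)) => [|i _]; last first.
    by rewrite !insert_lift.
  rewrite (eq_bigr Cs) => [|i _]; last exact: insert_lift.
  by rewrite B'E BE !cmulmxA.
do !split.
- exact: (@insertP _ _ _ _ _ (@row_swap_mx R n)).
- exact: (@insertP _ _ _ _ _ (@row_addition_mx R n)).
- exact: (@insertP _ _ _ _ _ (fun M => CRlt R (mxnorm M) (1 + delta))).
- exact: (@insertP _ _ _ _ _ (@col_swap_mx R m)).
Qed.

(** * One elimination step *)

Lemma multiplier_lt (x b a : T) (b0 : b ≶ 0) :
  0 <= a -> CRabs R x < a * CRabs R b -> CRabs R (- (x * (/ b) b0)) < a.
Proof.
move=> a0 xab; rewrite CRabs_opp.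
have b_pos : 0 < CRabs R b.
  apply: (CRmult_pos_pos _ a) => //; last exact: CRabs_pos.
  by rewrite CRmult_comm; apply: CRle_lt_trans (CRabs_pos x) xab.
apply: (CRmult_lt_reg_r (CRabs R b)) => //.
by rewrite -CRabs_mult CRmult_assoc CRinv_l CRmult_1_r.
Qed.

Lemma mxnorm_row_addition n (p : 'I_n) c a :
  1 < a -> (forall i, CRabs R (c i) < a) -> mxnorm (row_addition p c) < a.
Proof.
move=> a1 ca; have a0 : 0 < a by apply: CRlt_trans a1; exact: CRzero_lt_one.
apply: mxnorm_lt => // i j; rewrite mxE; case: eqP => _.
  by rewrite CRabs_right //; apply: CRlt_asym; exact: CRzero_lt_one.
by case: eqP => _ //; rewrite CRabs_right.
Qed.

(** An echelon form with k leading columns, without the bound on its residual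
    matrix. *)
Record triangular_upto (k n m : nat) (B : 'M[T]_(n, m)) : Type := {
  triangular_diag : forall (i : 'I_n) (j : 'I_m),
    (j < k)%N -> i = j :> nat -> B i j ≶ 0;
  triangular_below : forall (i : 'I_n) (j : 'I_m),
    (j < k)%N -> (j < i)%N -> B i j == 0
}.

Lemma tperm_lt k n (kn p x : 'I_n) :
  kn = k :> nat -> (k <= p)%N -> (x < k)%N -> tperm kn p x = x.
Proof.
move=> <- kp xk; apply: tpermD; apply/eqP => e; subst x.
  by rewrite ltnn in xk.
by rewrite ltnNge kp in xk.
Qed.

Lemma tperm_ge k n (kn p x : 'I_n) :
  kn = k :> nat -> (k <= p)%N -> (k <= x)%N -> (k <= tperm kn p x)%N.
Proof. by move=> <- kp kx; case: tpermP => [| |]. Qed.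

Section Step.

Variables (n m k : nat) (B : 'M[T]_(n, m)).
Variables (p kn : 'I_n) (q km : 'I_m).
Hypothesis pivot : B p q ≶ 0.

(** Rows above k keep a zero multiplier: their entries in column q are free, and
    nothing bounds them by the pivot. *)
Definition multiplier (i : 'I_n) : T :=
  if (k <= i)%N && (i != p) then - (B i q * (/ B p q) pivot) else 0.

Definition eliminate : 'M[T]_(n, m) :=
  xcol km q (xrow kn p (add_rows p multiplier B)).

Hypotheses (knE : kn = k :> nat) (kmE : km = k :> nat).
Hypotheses (kp : (k <= p)%N) (kq : (k <= q)%N).

Lemma multiplier_pivot : multiplier p == 0.
Proof. by rewrite /multiplier eqxx andbF. Qed.

Lemma eliminateE i j :
  eliminate i j = B (tperm kn p i) (tperm km q j)
                  + multiplier (tperm kn p i) * B p (tperm km q j).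
Proof. by rewrite !mxE. Qed.

(** Row p vanishes in the first k columns, and both swaps only involve indices
    at least k, so these columns keep their shape.  Column k is column q of the
    matrix before the swaps, with the pivot moved to the diagonal. *)
Lemma eliminate_triangular :
  triangular_upto k B -> triangular_upto k.+1 eliminate.
Proof.
case=> diag below; split=> i j; rewrite ltnS eliminateE.
- case: (ltngtP j k) => // jk _ ij; last first.
    have -> : i = kn by apply: val_inj; rewrite /= ij jk knE.
    have -> : j = km by apply: val_inj; rewrite /= jk kmE.
    by rewrite !tpermL multiplier_pivot CRmult_0_l CRplus_0_r.
  rewrite (tperm_lt kmE) // (tperm_lt knE) // ?ij //.
  rewrite (below p j) // ?(leq_trans jk) // CRmult_0_r CRplus_0_r.
  exact: diag.
- case: (ltngtP j k) => // jk _ ij.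
    rewrite (tperm_lt kmE) // (below p j) // ?(leq_trans jk) //.
    rewrite CRmult_0_r CRplus_0_r; apply: below => //.
    case: (ltnP i k) => ik; first by rewrite (tperm_lt knE).
    by rewrite (leq_trans jk) // (tperm_ge knE).
  have -> : j = km by apply: val_inj; rewrite /= jk kmE.
  rewrite tpermL /multiplier (tperm_ge knE) //=; last by rewrite -jk ltnW.
  (* only the diagonal row k receives the pivot row *)
  have -> /= : tperm kn p i != p.
    rewrite -{2}(tpermL kn p) (inj_eq perm_inj).
    by apply: contraTneq ij => ->; rewrite jk knE ltnn.
  rewrite -CRopp_mult_distr_l CRmult_assoc CRinv_l CRmult_1_r.
  exact: CRplus_opp_r.
Qed.

Lemma eliminate_stable (A : 'M[T]_(n, m)) :
  stable_ops A B -> stable_ops A eliminate.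
Proof.
move=> /(stable_ops_add_rows multiplier_pivot) AB.
apply: stable_ops_rcons (Stable_col_swap _ _ _).
exact: stable_ops_rcons AB (Stable_row_swap _ _ _).
Qed.

Lemma eliminate_factorization delta (A : 'M[T]_(n, m)) :
  0 < delta ->
  (forall i : 'I_n, (k <= i)%N ->
     CRabs R (B i q) < (1 + delta) * CRabs R (B p q)) ->
  factorization delta k A B -> factorization delta k.+1 A eliminate.
Proof.
move=> d0 dominated.
apply: (@factorizationS _ _ _ _ _ _ _ (xrow kn p (cmx1 R n))
  (row_addition p multiplier) (xcol km q (cmx1 R m))).
- by exists kn, p.
- exact: row_addition_mxP.
- apply: mxnorm_row_addition => [|i]; first exact: one_plus_gt1.
  have a0 := one_plus_gt0 d0; rewrite /multiplier.
  case: ifP => [/andP[ki _]|_]; last by rewrite CRabs_right.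
  by apply: multiplier_lt; [exact: CRlt_asym | exact: dominated].
- by exists km, q.
- rewrite row_additionE ?row_swap_mxE ?col_swap_mxE //.
  exact: multiplier_pivot.
Qed.

End Step.

Record elimination_state n m (delta : T) (A : 'M[T]_(n, m)) k B : Type := {
  state_triangular : triangular_upto k B;
  state_stable : stable_ops A B;
  state_factorization : factorization delta k A B
}.

Lemma elimination_step n m delta (A : 'M[T]_(n, m)) k B :
  0 < delta -> (k < minn n m)%N -> 0 < mxnorm (residual k B) ->
  elimination_state delta A k B -> {B' & elimination_state delta A k.+1 B'}.
Proof.
rewrite leq_min => d0 /andP[kn km] E0 [tri stab fact].
have [p [q dominated]] := approximate_pivot d0 E0.
set a := 1 + delta in dominated.
have pq0 : B (tail_ord p) (tail_ord q) ≶ 0.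
  apply: CRabs_appart_0; apply: (CRmult_pos_pos _ a).
  - rewrite CRmult_comm; have := dominated p q; rewrite mxE.
    exact/CRle_lt_trans/CRabs_pos.
  - exact: CRabs_pos.
  - exact/CRlt_asym/one_plus_gt0.
exists (eliminate k (Ordinal kn) (Ordinal km) pq0).
have kp : (k <= tail_ord p)%N by exact: leq_addr.
have kq : (k <= tail_ord q)%N by exact: leq_addr.
split.
- exact: eliminate_triangular.
- exact: eliminate_stable.
- apply: eliminate_factorization => // i ki.
  have ik : (i - k < n - k)%N by rewrite ltn_sub2r // (leq_ltn_trans ki).
  have := dominated (Ordinal ik) q; rewrite !mxE.
  by rewrite (_ : tail_ord (Ordinal ik) = i) //; apply: val_inj; exact: subnKC.
Qed.

Lemma mxnorm_empty n m (A : 'M[T]_(n, m)) x :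
  minn n m = 0%N -> 0 < x -> mxnorm A < x.
Proof.
move=> nm0 x0; apply: mxnorm_lt => // i j; exfalso.
have : (0 < minn n m)%N.
  by rewrite leq_min (leq_ltn_trans _ (ltn_ord i)) //
    (leq_ltn_trans _ (ltn_ord j)).
by rewrite nm0.
Qed.

Lemma elimination n m delta eps (A : 'M[T]_(n, m)) d k B :
  0 < delta -> 0 < eps -> (k + d = minn n m)%N ->
  elimination_state delta A k B ->
  {k' & {B' & ((k' <= minn n m)%N * elimination_state delta A k' B' *
               (mxnorm (residual k' B') < eps)%ConstructiveReals)%type}}.
Proof.
move=> d0 e0; elim: d k B => [|d IH] k B kd st.
  exists k, B; split; first by split; rewrite // -kd leq_addr.
  by apply: mxnorm_empty => //; rewrite -subn_minl -kd addn0 subnn.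
have cotrans := snd (CRltLinear R).
(* the test for termination; its two cases overlap *)
case: (cotrans 0 (mxnorm (residual k B)) eps e0) => [E0|small].
  have k_lt : (k < minn n m)%N by rewrite -kd -addSnnS leq_addr.
  have [B' st'] := elimination_step d0 k_lt E0 st.
  by apply: (IH k.+1 B') => //; rewrite addSnnS.
by exists k, B; do !split => //; rewrite -kd leq_addr.
Qed.

End ConstructiveGauss.

Theorem proposition4p21 (R : ConstructiveReals) (n m : nat)
    (A : 'M[CRcarrier R]_(n, m)) (delta eps : CRcarrier R)
    (delta_pos : (0 < delta)%ConstructiveReals)
    (eps_pos : (0 < eps)%ConstructiveReals) :
  {Aeps : 'M[CRcarrier R]_(n, m) &
    (echelon_form_of eps A Aeps *
     {k : nat &
      {P : 'I_k -> 'M[CRcarrier R]_n &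
      {S : 'I_k -> 'M[CRcarrier R]_n &
      {C : 'I_k -> 'M[CRcarrier R]_m &
        ((k <= minn n m)%N *
         (forall i, row_swap_mx (P i)) *
         (forall i, row_addition_mx (S i)) *
         (forall i, (mxnorm (S i) < 1 + delta)%ConstructiveReals) *
         (forall i, col_swap_mx (C i)) *
         meq Aeps
           (cmulmx
             (cmulmx
               (\big[@cmulmx R n n n / cmx1 R n]_(i < k) cmulmx (P i) (S i))
               A)
             (\big[@cmulmx R m m m / cmx1 R m]_(i < k) C i)))%type}}}})%type}.
Proof.
have start : elimination_state delta A 0 A.
  split; [by split | apply: Stable_nil => i j; exact: CReq_refl |].
  exact: factorization0.
have [k [B [[k_le [[diag below] stable fact]] small]]] :=
  elimination delta_pos eps_pos (add0n _) start.
exists B; split; first by split => //; exists k.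
case: fact => P [S [C [[[[rP rS] nS] cC] BE]]].
by exists k, P, S, C; exact: (k_le, rP, rS, nS, cC, BE).
Qed.
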